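(* Let $P$ be a $2$-torsion free prime ring with identity $1$ that contains a non-trivial idempotent $e_1$. Let $\{d_n\}_{n=0}^{\infty}$ be a commuting Jordan higher derivation on $P$, that is, a sequence of additive maps $d_n:P\to P$ such that, for all $x\in P$ and all non-negative integers $n$, $d_n(x^2)=\sum_{k=0}^{n} d_{n-k}(x)d_k(x)$, $d_0(x)=x$, and $[d_n(x),x]=0$. Then $d_n=0$ for all integers $n\geq 1$.
   Context: Rings are associative and not assumed commutative; $[a,b]=ab-ba$. A ring $P$ is prime if $p_1 P p_2 = 0$ implies $p_1=0$ or $p_2=0$; it is $2$-torsion free if $2p=0$ with $p\in P$ implies $p=0$. An idempotent $e_1$ ($e_1^2=e_1$) is non-trivial if $e_1\neq 0$ and $e_1\neq 1$. *)

(* Defs.v *)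
From HB Require Import structures.
From mathcomp Require Import all_boot all_order all_algebra.

Set Implicit Arguments.
Unset Strict Implicit.
Unset Printing Implicit Defensive.

Import GRing.Theory.
Local Open Scope ring_scope.

Definition lie_bracket (P : pzRingType) (a b : P) : P := a * b - b * a.

Definition prime_ring (P : pzRingType) : Prop :=
  forall p1 p2 : P, (forall p : P, p1 * p * p2 = 0) -> p1 = 0 \/ p2 = 0.

Definition two_torsion_free (P : pzRingType) : Prop :=
  forall p : P, p *+ 2 = 0 -> p = 0.

Definition nontrivial_idempotent (P : pzRingType) (e : P) : Prop :=
  [/\ e * e = e, e <> 0 & e <> 1].

Definition jordan_higher_derivation (P : pzRingType)
    (d : nat -> {additive P -> P}) : Prop :=
  (forall x : P, d 0%N x = x) /\
  (forall (n : nat) (x : P),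
     d n (x ^+ 2) = \sum_(0 <= k < n.+1) d (n - k)%N x * d k x).

Definition commuting_family (P : pzRingType)
    (d : nat -> {additive P -> P}) : Prop :=
  forall (n : nat) (x : P), lie_bracket (d n x) x = 0.

(* Main.v *)
Require Import Defs.
From HB Require Import structures.
From mathcomp Require Import all_boot all_order all_algebra.

(** The first nonzero term [d n] with [n >= 1] of a Jordan higher derivation is
    a Jordan derivation, because every mixed product in the formula for
    [d n (x ^+ 2)] involves an earlier term. By strong induction, it therefore
    suffices that a commuting Jordan derivation [D] vanishes.

    The idempotent makes this direct, without going through the theorems that a
    Jordan derivation of a prime ring is a derivation (Herstein) and that a
    commuting derivation of a noncommutative prime ring is zero (Posner).
    Write [f = 1 - e]. Commutation forces [D e = 0] ([commuting_jordan_idem]),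
    and then every value of [D] commutes with [e] ([commuting_values_idem]).
    On the off-diagonal Peirce components [e P f] and [f P e] an element [x]
    equals [e x + x e], so that [D x = 2 e (D x)], and left multiplication by
    [e] gives [D x = 0] ([commuting_jordan_offdiag]). If [a] lies in the corner
    [e P e], then so does [D a], since [2 D a = 2 e (D a)] and [P] is 2-torsion
    free, and for [m] in [e P f] the product
    [a m = a m + m a] is again off-diagonal; expanding [0 = D (a m + m a)]
    leaves [(D a) m = 0]. Hence [(D a) P f = 0], and primeness gives [D a = 0]
    since [f] is nonzero ([commuting_jordan_corner]). Exchanging [e] and [f]
    takes care of [f P f], and the four components span [P]. *)

Set Implicit Arguments.
Unset Strict Implicit.
Unset Printing Implicit Defensive.

Import GRing.Theory.
Local Open Scope ring_scope.

Definition jordan_derivation (P : pzRingType) (D : P -> P) : Prop :=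
  forall x, D (x * x) = D x * x + x * D x.

Definition commuting_map (P : pzRingType) (D : P -> P) : Prop :=
  forall x, D x * x = x * D x.

(** Expansion with the diagonal and the cross terms grouped, so that
    linearizing a quadratic identity amounts to cancelling its diagonal part. *)
Lemma mulr_add_cross (P : pzRingType) (x y z t : P) :
  (x + y) * (z + t) = (x * z + y * t) + (x * t + y * z).
Proof. by rewrite mulrDl !mulrDr (AC (2*2) ((1*4)*(2*3))). Qed.

Lemma jordan_linearized (P : pzRingType) (D : {additive P -> P}) (x y : P) :
  jordan_derivation D ->
  D (x * y + y * x) = (D x * y + D y * x) + (x * D y + y * D x).
Proof.
move=> DJ; have := DJ (x + y).
rewrite mulr_add_cross [D (x + y)]raddfD !mulr_add_cross.
rewrite raddfD [D (x * x + _)]raddfD !DJ [RHS]addrACA [X in X + _ = _]addrACA.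
exact: addrI.
Qed.

Lemma commuting_linearized (P : pzRingType) (D : {additive P -> P}) (x y : P) :
  commuting_map D -> D x * y + D y * x = x * D y + y * D x.
Proof.
move=> DC; have := DC (x + y).
rewrite raddfD !mulr_add_cross !DC; exact: addrI.
Qed.

Section CommutingJordanDerivation.

Variables (P : pzRingType) (D : {additive P -> P}).
Hypotheses (DJ : jordan_derivation D) (DC : commuting_map D).

Section Idempotent.

Variable e : P.
Hypothesis ee : e * e = e.

Lemma commuting_jordan_idem : D e = 0.
Proof.
have De : D e = e * D e + e * D e by rewrite -{1}ee DJ DC.
have eDe : e * D e = 0.
  by apply: (addrI (e * D e)); rewrite addr0 {3}De mulrDr !mulrA ee.
by rewrite De eDe addr0.
Qed.

Lemma commuting_values_idem x : D x * e = e * D x.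
Proof.
have := commuting_linearized x e DC.
by rewrite commuting_jordan_idem mul0r mulr0 addr0 add0r.
Qed.

Lemma commuting_jordan_anticomm_idem x :
  D (e * x + x * e) = e * D x + e * D x.
Proof.
by rewrite jordan_linearized // commuting_jordan_idem mul0r mulr0 addr0 add0r
  commuting_values_idem.
Qed.

(** The hypothesis cuts out the sum of the two off-diagonal Peirce components,
    so that both are treated at once. *)
Lemma commuting_jordan_offdiag x : e * x + x * e = x -> D x = 0.
Proof.
move=> xoff; have Dx := commuting_jordan_anticomm_idem x.
rewrite xoff in Dx.
have eDx : e * D x = 0.
  by apply: (addrI (e * D x)); rewrite addr0 {3}Dx mulrDr !mulrA ee.
by rewrite Dx eDx addr0.
Qed.

Lemma commuting_jordan_corner_stable x :
  two_torsion_free P -> e * x = x -> x * e = x -> e * D x = D x.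
Proof.
move=> P2tf ex xe; apply/eqP; rewrite -subr_eq0; apply/eqP/P2tf.
have := commuting_jordan_anticomm_idem x.
by rewrite ex xe raddfD /= => H; rewrite mulrnBl !mulr2n H subrr.
Qed.

(** Off-diagonal elements separate the elements of the corner: an element of
    [e P e] killing [e P (1 - e)] from the left is zero by primeness. *)
Lemma commuting_jordan_corner x :
  prime_ring P -> two_torsion_free P -> e <> 1 ->
  e * x = x -> x * e = x -> D x = 0.
Proof.
move=> Pprime P2tf e1 ex xe.
have eDx := commuting_jordan_corner_stable P2tf ex xe.
have fe : (1 - e) * e = 0 by rewrite mulrBl mul1r ee subrr.
have Dxf p : D x * p * (1 - e) = 0.
  pose m := e * p * (1 - e).
  have em : e * m = m by rewrite /m !mulrA ee.
  have me : m * e = 0 by rewrite /m -mulrA fe mulr0.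
  have Dm : D m = 0 by apply: commuting_jordan_offdiag; rewrite em me addr0.
  have mx : m * x = 0 by rewrite -ex mulrA me mul0r.
  have mDx : m * D x = 0 by rewrite -eDx mulrA me mul0r.
  have Dxm : D (x * m) = 0.
    apply: commuting_jordan_offdiag.
    by rewrite mulrA ex -[x * m * e]mulrA me mulr0 addr0.
  have := jordan_linearized x m DJ.
  rewrite mx addr0 Dxm Dm mDx mulr0 mul0r !addr0 => Dx_m.
  by rewrite -{1}eDx -commuting_values_idem Dx_m /m !mulrA.
case: (Pprime _ _ Dxf) => // /eqP; rewrite subr_eq0 => /eqP e1'.
by case: e1.
Qed.

End Idempotent.

Lemma commuting_jordan_eq0 (e : P) :
  prime_ring P -> two_torsion_free P -> nontrivial_idempotent e ->
  forall x, D x = 0.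
Proof.
move=> Pprime P2tf [ee e0 e1] x.
pose f := 1 - e.
have fe : f * e = 0 by rewrite mulrBl mul1r ee subrr.
have ef : e * f = 0 by rewrite mulrBr mulr1 ee subrr.
have ef1 : e + f = 1 by rewrite addrC subrK.
have ff : f * f = f by rewrite {2}/f mulrBr mulr1 fe subr0.
have f1 : f <> 1.
  by move=> f1; apply: e0; rewrite -[e]mul1r -f1 fe.
have -> : x = (e * x * e + e * x * f) + (f * x * e + f * x * f).
  by rewrite -!mulrDr ef1 !mulr1 -mulrDl ef1 mul1r.
have De : D (e * x * e) = 0.
  by apply: (commuting_jordan_corner ee) => //;
    [rewrite !mulrA | rewrite -!mulrA]; rewrite ee.
have Df : D (f * x * f) = 0.
  by apply: (commuting_jordan_corner ff) => //;
    [rewrite !mulrA | rewrite -!mulrA]; rewrite ff.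
have Def : D (e * x * f) = 0.
  by apply: (commuting_jordan_offdiag ee);
    rewrite !mulrA ee -[_ * f * e]mulrA fe mulr0 addr0.
have Dfe : D (f * x * e) = 0.
  by apply: (commuting_jordan_offdiag ee);
    rewrite !mulrA ef !mul0r add0r -[_ * e * e]mulrA ee.
by rewrite !raddfD /= De Df Def Dfe !addr0.
Qed.

End CommutingJordanDerivation.

Lemma jordan_higher_first_term (P : pzRingType) (d : nat -> {additive P -> P})
    (n : nat) :
  jordan_higher_derivation d -> (0 < n)%N ->
  (forall k, (0 < k < n)%N -> forall x, d k x = 0) ->
  jordan_derivation (d n).
Proof.
case: n => // n [d0 dJ] _ dlt x.
rewrite -expr2 dJ big_nat_recr //= big_nat_recl //= big_nat big1 => [|k kn].
  by rewrite subn0 subnn !d0 addr0.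
by rewrite (dlt k.+1) ?mulr0.
Qed.

Theorem corollary2p8 (P : pzRingType) (e1 : P)
    (d : nat -> {additive P -> P})
    (Pprime : prime_ring P)
    (P2tf : two_torsion_free P)
    (e1_idem : nontrivial_idempotent e1)
    (dJ : jordan_higher_derivation d)
    (dcomm : commuting_family d) :
  forall n : nat, (1 <= n)%N -> forall x : P, d n x = 0.
Proof.
elim/ltn_ind => n IHn n_gt0.
apply: (commuting_jordan_eq0 _ _ Pprime P2tf e1_idem).
- apply: jordan_higher_first_term => // k /andP[k_gt0 k_lt].
  exact: IHn.
- by move=> x; apply/eqP; rewrite -subr_eq0; apply/eqP/dcomm.
Qed.
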